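(* Let $n\ge 2$, $c>0$ and $\alpha>0$ be such that the fractional Hadamard power $H^{\circ\alpha}$ of the $n\times n$ generalized Hilbert matrix $H=\left(\frac{1}{i+j-2+c}\right)_{i,j=1}^n$ is positive definite. For $m\ge 2$, let $\mathcal{A}=(a_{i_1\dots i_m})$ be the $m$th order $n$-dimensional generalized Hilbert tensor $a_{i_1\dots i_m}=\frac{1}{i_1+\dots+i_m-m+c}$. Then $\mathcal{A}^{\circ\alpha}$ is strongly completely positive, and if $m$ is even then $\mathcal{A}^{\circ\alpha}$ is positive definite.
   Context: For a nonnegative tensor $\mathcal{A}=(a_{i_1\dots i_m})$ and $\alpha>0$, its fractional Hadamard power is $\mathcal{A}^{\circ\alpha}=(a_{i_1\dots i_m}^{\alpha})$. A symmetric tensor of order $m$, dimension $n$ is strongly completely positive if it equals $\sum_{k=1}^r(\mathbf{u}^{(k)})^m$ for nonnegative vectors $\mathbf{u}^{(k)}\in\mathbb{R}^n$ spanning $\mathbb{R}^n$, where $\mathbf{u}^m$ has entries $u_{i_1}\cdots u_{i_m}$. For even $m$, a symmetric tensor $(b_{i_1\dots i_m})$ is positive definite if $\sum b_{i_1\dots i_m}x_{i_1}\cdots x_{i_m}>0$ for all nonzero $\mathbf{x}\in\mathbb{R}^n$. *)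

(* Defs.v *)
From HB Require Import structures.
From mathcomp Require Import all_boot all_order all_algebra fingroup perm.
From mathcomp Require Import reals exp.
Set Implicit Arguments. Unset Strict Implicit. Unset Printing Implicit Defensive.
Import Order.TTheory GRing.Theory Num.Theory.
Local Open Scope ring_scope.

(* Indices are 0-based: i : 'I_n stands for the paper's index i+1. *)

Definition midx (m n : nat) := {ffun 'I_m -> 'I_n}.

Definition tensor (R : realType) (m n : nat) := midx m n -> R.

Definition hpow_tensor (R : realType) m n (A : tensor R m n) (alpha : R)
  : tensor R m n := fun i => powR (A i) alpha.

Definition hpow_mx (R : realType) n (M : 'M[R]_n) (alpha : R) : 'M[R]_n :=
  \matrix_(i, j) powR (M i j) alpha.

(* Generalized Hilbert matrix H_{ij} = 1/(i+j-2+c) (1-based) *)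
Definition gen_hilbert_mx (R : realType) n (c : R) : 'M[R]_n :=
  \matrix_(i, j) (i%:R + j%:R + c)^-1.

(* Generalized Hilbert tensor a_{i1..im} = 1/(i1+...+im-m+c) (1-based) *)
Definition gen_hilbert_tensor (R : realType) m n (c : R) : tensor R m n :=
  fun i => ((\sum_(k < m) (i k : nat))%:R + c)^-1.

Definition posdef_mx (R : realType) n (M : 'M[R]_n) : Prop :=
  forall x : 'cV[R]_n, x != 0 -> 0 < (x^T *m M *m x) 0 0.

Definition symmetric_tensor (R : realType) m n (A : tensor R m n) : Prop :=
  forall (s : 'S_m) (i : midx m n), A [ffun k => i (s k)] = A i.

Definition rank1_tensor (R : realType) m n (u : 'I_n -> R) : tensor R m n :=
  fun i => \prod_(k < m) u (i k).

(* Strongly completely positive: symmetric and a sum of u^(k)^m with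
   nonnegative u^(k) spanning R^n (the matrix with rows u^(k) has full
   column rank n). *)
Definition strongly_cp (R : realType) m n (A : tensor R m n) : Prop :=
  symmetric_tensor A /\
  exists (r : nat) (U : 'M[R]_(r, n)),
    (forall k j, 0 <= U k j) /\ row_full U /\
    forall i, A i = \sum_(k < r) @rank1_tensor R m n (fun j => U k j) i.

Definition posdef_tensor (R : realType) m n (A : tensor R m n) : Prop :=
  symmetric_tensor A /\
  forall x : 'I_n -> R, (exists j, x j != 0) ->
    0 < \sum_(i : midx m n) A i * \prod_(k < m) x (i k).

(* Main.v *)
Require Import Defs.
From HB Require Import structures.
From mathcomp Require Import all_boot all_order all_algebra fingroup perm.
From mathcomp Require Import reals exp.
From mathcomp Require Import ring.
From mathcomp Require Import boolp classical_sets topology normedtype.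
From mathcomp Require Import derive realfun.
Import Order.TTheory GRing.Theory Num.Theory.
Import numFieldNormedType.Exports.
Local Open Scope ring_scope.

(** The entry of index (i_1, ..., i_m) is h(s) = (s + c)^-alpha with
s = i_1 + ... + i_m, so it suffices to write h on {0, ..., m n} as a finite sum
of terms w t^s with w, t >= 0: each term contributes the m-th tensor power of
the vector w^(1/m) (1, t, ..., t^(n-1)), and n distinct nodes t of positive
weight make these vectors span.

All iterated differences of h are positive, so h is a Hausdorff moment sequence,
and Bernstein's formula approximates it on {0, ..., N} by finite sums of terms
w t^s. To make the representation exact, let e(s) = 0^s + 1^s + ... + N^s. The
N+1 shifts (s + j + c)^-alpha, 1 <= j <= N+1, are linearly independent on
{0, ..., N} (by Rolle's theorem), so a small multiple d e is there a combination
of them with small coefficients, and subtracting that combination from h keeps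
all differences nonnegative. Hence h - d e is approximated by such sums, and by
invertibility of the Vandermonde matrix the error is a combination of the powers
j^s with coefficients smaller than d, which is absorbed by d e. *)

(** * Derivatives on the positive half-line *)

Lemma MVT_gt0 {R : realType} (f f' : R -> R) (a b : R) :
  (forall x : R, 0 < x -> is_derive x (1 : R) f (f' x)) -> 0 < a -> a < b ->
  exists2 z, a < z < b & f b - f a = f' z * (b - a).
Proof.
move=> df a0 ab; have [||z zab e] := @MVT R f f' a b ab.
- by move=> x; rewrite in_itv /= => /andP[ax _]; apply/df/(lt_trans a0).
- apply: continuous_in_subspaceT => x; rewrite inE /= in_itv /= => /andP[ax _].
  apply: differentiable_continuous; apply/derivable1_diffP.
  by have [] := df x (lt_le_trans a0 ax).
- by exists z; [rewrite in_itv in zab|].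
Qed.

Lemma is_derive_shift {R : realType} (f : R -> R) (t x df : R) :
  is_derive (x + t) (1 : R) f df -> is_derive x (1 : R) (fun y => f (y + t)) df.
Proof.
move=> dfx; rewrite -[df]mulr1.
apply: (@is_derive1_comp _ f (fun y => y + t)).
by rewrite -[X in is_derive _ _ _ X]addr0; apply: is_deriveD.
Qed.

Lemma is_derive_shift_powR {R : realType} (t a x : R) : 0 <= t -> 0 < x ->
  is_derive x (1 : R) (fun y => (y + t) `^ a) (a * (x + t) `^ (a - 1)).
Proof.
move=> t0 x0; apply: (is_derive_shift (fun z => z `^ a)).
by apply: is_derive1_powR; rewrite ltr_wpDr.
Qed.

(** * Iterated differences of negative powers *)

(** The sign is (-1)^k times that of the usual forward difference, so that complete monotonicity
    reads [0 <= fdiff k g s]. *)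
Fixpoint fdiff {V : zmodType} (k : nat) (g : nat -> V) (s : nat) : V :=
  if k is k'.+1 then fdiff k' g s - fdiff k' g s.+1 else g s.

(** The same differences at a real argument, where they can be differentiated. *)
Fixpoint powR_diff {R : realType} (a : R) (k : nat) (x : R) : R :=
  if k is k'.+1 then powR_diff a k' x - powR_diff a k' (x + 1)
  else x `^ (- a).

Lemma fdiff_powR (R : realType) (a c : R) k s :
  fdiff k (fun s => (s%:R + c) `^ (- a)) s = powR_diff a k (s%:R + c).
Proof.
elim: k s => //= k IH s; rewrite !IH.
by congr (_ - powR_diff _ _ _); rewrite -natr1 addrAC.
Qed.

Lemma is_derive_powR_diff (R : realType) (a : R) k (x : R) : 0 < x ->
  is_derive x (1 : R) (powR_diff a k) (- a * powR_diff (a + 1) k x).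
Proof.
elim: k x => [|k IH] x x0 /=.
  by rewrite opprD; apply: is_derive1_powR.
rewrite mulrBr; apply: is_deriveB; first exact: IH.
by apply: (is_derive_shift (powR_diff a k)); apply: IH; rewrite addr_gt0.
Qed.

(* The derivative of the k-th difference of x^-a is -a times that of x^-(a+1),
   so positivity at order k, for all exponents, gives monotonicity at order k,
   which is positivity at order k+1. *)
Lemma powR_diff_gt0_decr (R : realType) (k : nat) :
  (forall a x : R, 0 < a -> 0 < x -> 0 < powR_diff a k x) /\
  (forall a x y : R, 0 < a -> 0 < x -> x < y ->
     powR_diff a k y < powR_diff a k x).
Proof.
have decr j : (forall a x : R, 0 < a -> 0 < x -> 0 < powR_diff a j x) ->
    forall a x y : R, 0 < a -> 0 < x -> x < y ->
     powR_diff a j y < powR_diff a j x.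
  move=> pos a x y a0 x0 xy.
  have [z /andP[xz _] e] := MVT_gt0 _ _ _ _
    (fun x => is_derive_powR_diff R a j x) x0 xy.
  rewrite -subr_lt0 e !mulNr oppr_lt0 !mulr_gt0 ?subr_gt0 ?pos //.
    by rewrite addr_gt0.
  exact: lt_trans xz.
elim: k => [|k [_ IH]].
  have pos (a x : R) : 0 < a -> 0 < x -> 0 < powR_diff a 0 x.
    by move=> _ x0; apply: powR_gt0.
  by split; [exact: pos | exact: decr].
have pos (a x : R) : 0 < a -> 0 < x -> 0 < powR_diff a k.+1 x.
  by move=> a0 x0; rewrite /= subr_gt0 IH // ltrDl.
by split; [exact: pos | exact: decr].
Qed.

(** * Linear independence of shifted powers *)

(** Rolle's theorem between consecutive zeros. Recording the new zeros as a path from [z] keeps them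
    increasing and positive, ready for another round. *)
Lemma Rolle_seq {R : realType} (f f' : R -> R) (z : R) (zs : seq R) :
  (forall x : R, 0 < x -> is_derive x (1 : R) f (f' x)) ->
  0 < z -> path <%R z zs ->
  (forall x, x \in z :: zs -> f x = 0) ->
  exists ws, [/\ size ws = size zs, path <%R z ws &
    forall x, x \in ws -> f' x = 0].
Proof.
move=> df; elim: zs z => [|y zs IH] z z0 /=; first by exists [::].
move=> /andP[zy pzs] f0.
have [x xI|ws [sz pws w0]] := IH y (lt_trans z0 zy) pzs.
  by apply: f0; rewrite inE xI orbT.
have [w /andP[zw wy]] := MVT_gt0 _ _ _ _ df z0 zy.
rewrite !f0 ?inE ?eqxx ?orbT // subrr => /esym/eqP.
rewrite mulf_eq0 subr_eq0 (gt_eqF zy) orbF => /eqP fw.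
exists (w :: ws); split => /=; first by rewrite sz.
  rewrite zw /=; case: ws pws {sz w0} => //= v ws /andP[yv ->].
  by rewrite (lt_trans wy yv).
by move=> x; rewrite inE => /predU1P[->|/w0].
Qed.

(* Multiplying by (x + t0)^a, for t0 the first shift, and differentiating
   removes one term. *)
Lemma shifted_powR_indep (R : realType) (ts : seq R) (a : R) (b : R -> R)
    (zs : seq R) :
  uniq ts -> (forall t, t \in ts -> 0 <= t) -> 0 < a ->
  sorted <%R zs -> (forall z, z \in zs -> 0 < z) -> size zs = size ts ->
  (forall z, z \in zs -> \sum_(t <- ts) b t * (z + t) `^ (- a) = 0) ->
  forall t, t \in ts -> b t = 0.
Proof.
elim: ts a b zs => [|t0 ts IH] a b [|z zs] //= /andP[t0ts uts] tge0 a0 pzs zpos.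
move=> [sz] f0.
have t00 : 0 <= t0 by apply: tge0; rewrite inE eqxx.
have tsge0 t : t \in ts -> 0 <= t.
  by move=> tI; apply: tge0; rewrite inE tI orbT.
have z0 : 0 < z by apply: zpos; rewrite inE eqxx.
pose g x := b t0 + \sum_(t <- ts) b t * ((x + t0) `^ a * (x + t) `^ (- a)).
(* Factoring [(x + t0)^(a - 1) (x + t)^-(a + 1)] out of the product rule leaves
   [a ((x + t) - (x + t0))], whence the coefficient [a * (t - t0)]. *)
pose h x := \sum_(t <- ts) (a * (t - t0) * b t) * (x + t) `^ (- (a + 1)).
have dg (x : R) : 0 < x -> is_derive x 1 g ((x + t0) `^ (a - 1) * h x).
  move=> x0; rewrite /g /h -[_ * _]add0r; apply: is_deriveD.
  rewrite mulr_sumr.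
  elim: ts tsge0 {IH t0ts uts tge0 sz f0 g h} => [|t ts IHt] tsge0.
    under eq_fun do rewrite big_nil.
    by rewrite big_nil; apply: is_derive_cst.
  under eq_fun do rewrite big_cons.
  rewrite big_cons; apply: is_deriveD; last first.
    by apply: IHt => u uI; apply: tsge0; rewrite inE uI orbT.
  have tge : 0 <= t by apply: tsge0; rewrite inE eqxx.
  have xt : 0 < x + t by rewrite ltr_wpDr.
  have xt0 : 0 < x + t0 by rewrite ltr_wpDr.
  have D1 := is_derive_shift_powR t0 a x t00 x0.
  have D2 := is_derive_shift_powR t (- a) x tge x0.
  have D := is_deriveZ (b t) (is_deriveM D1 D2).
  refine (is_derive_eq D _).
  have e1 : (x + t0) `^ a = (x + t0) `^ (a - 1) * (x + t0).
    by rewrite -{3}(powRr1 (ltW xt0)) -powRD ?subrK // (gt_eqF xt0) implybT.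
  have e2 : (x + t) `^ (- a) = (x + t) `^ (- (a + 1)) * (x + t).
    rewrite -{3}(powRr1 (ltW xt)) -powRD ?(gt_eqF xt) ?implybT //.
    by congr powR; ring.
  rewrite /GRing.scale /= e1 e2 -opprD; ring.
have gE (x : R) : 0 < x ->
    g x = (x + t0) `^ a * \sum_(t <- t0 :: ts) b t * (x + t) `^ (- a).
  move=> x0; rewrite big_cons mulrDr mulrCA -powRD; last first.
    by rewrite subrr eqxx gt_eqF // ltr_wpDr.
  rewrite subrr powRr0 mulr1 mulr_sumr; congr (_ + _).
  by apply: eq_bigr => t _; rewrite mulrCA.
have [|ws [sw pws w0]] := Rolle_seq g _ z zs dg z0 pzs.
  by move=> x xI; rewrite gE ?zpos // f0 // mulr0.
have wsgt : forall w, w \in ws -> 0 < w.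
  have := order_path_min lt_trans pws => /allP H w /H; exact: lt_trans.
(* Induction at exponent [a + 1] kills [a * (t - t0) * b t], and [t] differs from [t0] because the
   shifts are distinct. *)
have bts t : t \in ts -> b t = 0.
  move=> tI; have /eqP : a * (t - t0) * b t = 0.
    apply: (IH (a + 1) (fun t => a * (t - t0) * b t) ws) => //.
    - by rewrite addr_gt0.
    - exact: path_sorted pws.
    - by rewrite sw.
    move=> w wI; have /eqP := w0 w wI; rewrite mulf_eq0 => /orP[|/eqP//].
    by rewrite gt_eqF // powR_gt0 // ltr_wpDr // wsgt.
  rewrite !mulf_eq0 (gt_eqF a0) subr_eq0 /= => /orP[/eqP tt|/eqP//].
  by rewrite -tt tI in t0ts.
move=> t; rewrite inE => /predU1P[->|/bts//].
have := f0 z; rewrite inE eqxx => /(_ isT) /eqP; rewrite big_cons.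
rewrite big_seq big1 => [|u uI]; last by rewrite bts // mul0r.
by rewrite addr0 mulf_eq0 [X in _ || X]gt_eqF ?powR_gt0 ?ltr_wpDr //
  orbF => /eqP.
Qed.

(** * Bernstein approximation of completely monotone sequences *)

(** With E the shift operator, this is the binomial expansion of ((1 - E) + E)^M = 1. *)
Lemma fdiff_binomial {V : zmodType} (g : nat -> V) (M s : nat) :
  \sum_(k < M.+1) fdiff (M - k) g (s + k) *+ 'C(M, k) = g s.
Proof.
elim: M s => [|M IH] s; first by rewrite big_ord1 addn0.
rewrite big_ord_recl bin0 addn0 subn0.
under eq_bigr => k _ do rewrite binS mulrnDr /= subSS.
rewrite big_split addrA /=.
have -> : fdiff M g s - fdiff M g s.+1 +
    \sum_(k < M.+1) fdiff (M - k) g (s + k.+1) *+ 'C(M, k.+1) =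
    \sum_(k < M.+1) fdiff (M.+1 - k) g (s + k) *+ 'C(M, k).
  have -> : fdiff M g s - fdiff M g s.+1 = fdiff M.+1 g s *+ 'C(M, 0).
    by rewrite bin0.
  transitivity (\sum_(k < M.+2) fdiff (M.+1 - k) g (s + k) *+ 'C(M, k)).
    by rewrite [RHS]big_ord_recl addn0 subn0; congr (_ + _).
  by rewrite big_ord_recr /= bin_small // mulr0n addr0.
rewrite -[RHS]IH -big_split; apply: eq_bigr => k _ /=.
have kM : (k <= M)%N by rewrite -ltnS.
by rewrite subSn // -mulrnDl /= addnS subrK.
Qed.

(** Both sides count pairs of a k-subset of an M-set and an injective s-tuple of its elements. *)
Lemma bin_ffact_sub (M k s : nat) : (s <= k <= M)%N ->
  ('C(M, k) * k ^_ s = 'C(M - s, k - s) * M ^_ s)%N.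
Proof.
move=> /andP[sk kM]; apply/eqP; rewrite -(eqn_pmul2r (fact_gt0 (k - s))).
rewrite -mulnA ffact_fact // bin_ffact mulnAC bin_ffact mulnC.
have sM := leq_trans sk kM.
rewrite -(eqn_pmul2r (fact_gt0 (M - k))) -!mulnA ffact_fact //.
have -> : (M - k = M - s - (k - s))%N by rewrite subnBA // subnK.
by rewrite ffact_fact ?leq_sub2r // ffact_fact.
Qed.

(** This is the binomial expansion of order [M - s] at [s], reindexed so that the weights no longer
    depend on [s]; the falling factorials stand in for the powers (k/M)^s. *)
Lemma fdiff_bernstein {R : numFieldType} (g : nat -> R) (M s : nat) :
  (s <= M)%N ->
  g s = \sum_(k < M.+1) (fdiff (M - k) g k *+ 'C(M, k)) *
                        ((k ^_ s)%:R / (M ^_ s)%:R).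
Proof.
move=> sM; have Ms0 : (M ^_ s)%:R != 0 :> R.
  by rewrite pnatr_eq0 -lt0n ffact_gt0.
rewrite -(big_mkord xpredT (fun k => (fdiff (M - k) g k *+ 'C(M, k)) *
  ((k ^_ s)%:R / (M ^_ s)%:R))).
(* The terms with k < s vanish, since [k ^_ s] is then 0. *)
rewrite (big_cat_nat (leq0n s)) ?leqW //= big_nat_cond big1 ?add0r; last first.
  by move=> k /andP[/andP[_ ks] _]; rewrite ffact_small // mul0r mulr0.
rewrite -{2}[s]add0n big_addn subSn // big_mkord.
rewrite -[LHS](fdiff_binomial _ (M - s)).
apply: eq_bigr => k _; have kM : (k <= M - s)%N by rewrite -ltnS.
rewrite (addnC s) (_ : (M - (k + s) = M - s - k)%N); last first.
  by rewrite addnC subnDA.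
rewrite -[LHS]mulr_natr (mulrnAl (fdiff _ _ _)) -[RHS]mulr_natr -mulrA.
congr (_ * _); rewrite mulrAC -natrM mulnC.
rewrite bin_ffact_sub; last by rewrite leq_addl addnC -leq_subRL.
by rewrite addnK natrM mulfK.
Qed.

(** The i-th factors (k - i)/(M - i) and k/M lie in [0, 1] and differ by at most i/M, so the errors
    add up to at most (0 + 1 + ... + (s - 1))/M. *)
Lemma ffact_ratio_bound {R : realFieldType} (M k s : nat) :
  (0 < M)%N -> (s <= M)%N -> (k <= M)%N ->
  [/\ 0 <= (k ^_ s)%:R / (M ^_ s)%:R :> R &
  `|(k ^_ s)%:R / (M ^_ s)%:R - (k%:R / M%:R) ^+ s| <= (s ^ 2)%:R / M%:R :> R].
Proof.
move=> M0 + kM; elim: s => [|s IH] sM.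
  by rewrite !ffactn0 expr0 divr1 subrr normr0 mul0r ler01.
have [A0 IHs] := IH (ltnW sM).
split; first by rewrite divr_ge0.
have M0' : 0 < M%:R :> R by rewrite ltr0n.
have Ms : 0 < (M - s)%:R :> R by rewrite ltr0n subn_gt0.
rewrite !ffactnSr !natrM invfM exprSr mulrACA.
set A := _ / _ in A0 IHs *; set a := (k - s)%:R / _; set B := _ ^+ s in IHs *.
set b := k%:R / _ in B IHs *.
have b0 : 0 <= b by rewrite divr_ge0.
have b1 : b <= 1 by rewrite ler_pdivrMr // mul1r ler_nat.
have a0 : 0 <= a by rewrite divr_ge0.
have a1 : a <= 1 by rewrite ler_pdivrMr // mul1r ler_nat leq_sub2r.
have B0 : 0 <= B by rewrite exprn_ge0.
have B1 : B <= 1 by rewrite exprn_ile1.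
have ab : `|a - b| <= s%:R / M%:R.
  have [ks|sk] := ltnP k s.
    (* Truncated subtraction makes [k - s] zero here, and k/M is below s/M. *)
    have -> : a = 0 by rewrite /a (eqP (ltnW ks)) mul0r.
    rewrite sub0r normrN ger0_norm // ler_pM2r ?invr_gt0 //.
    by rewrite ler_nat ltnW.
  have e : b - a = s%:R / M%:R * ((M - k)%:R / (M - s)%:R).
    rewrite /a /b !natrB // ?(ltnW sM) //.
    rewrite natrB ?(ltnW sM) // in Ms.
    by field; rewrite !lt0r_neq0.
  rewrite distrC e ger0_norm; last by rewrite !mulr_ge0 ?invr_ge0.
  rewrite ler_piMr ?divr_ge0 // ler_pdivrMr // mul1r ler_nat.
  exact: leq_sub2l.
have -> : A * a - B * b = (A - B) * a + B * (a - b) by ring.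
apply: le_trans (ler_normD _ _) _.
rewrite (normrM (A - B)) (normrM B) (ger0_norm a0) (ger0_norm B0).
apply: (@le_trans _ _ (`|A - B| + `|a - b|)).
  by apply: lerD; [exact: ler_piMr | exact: ler_piMl].
apply: le_trans (lerD IHs ab) _.
rewrite -mulrDl ler_pM2r ?invr_gt0 // -natrD -natrM ler_nat.
by rewrite -mulnn mulSn mulnS addnC leq_addl.
Qed.

(** The Bernstein weights are nonnegative with total [g 0], so replacing falling factorials by
    powers costs at most [g 0] times N^2/M. *)
Lemma completely_monotone_approx {R : archiRealFieldType} (g : nat -> R)
    (N : nat) (eps : R) :
  (forall k s, 0 <= fdiff k g s) -> 0 < eps ->
  exists r (w t : 'I_r -> R),
    [/\ forall k, 0 <= w k, forall k, 0 <= t k &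
      forall s, (s <= N)%N -> `|g s - \sum_(k < r) w k * t k ^+ s| <= eps].
Proof.
move=> cm e0; pose x := (N ^ 2)%:R * g 0 / eps.
have x0 : 0 <= x by rewrite divr_ge0 ?(ltW e0) // mulr_ge0 //; exact: (cm 0 0).
(* [M] exceeds both [N] and [N^2 g(0) / eps]. *)
pose M := (N + Num.bound x).+1.
have M0 : 0 < M%:R :> R by rewrite ltr0n.
exists M.+1, (fun k => fdiff (M - k) g k *+ 'C(M, k)), (fun k => k%:R / M%:R).
have w0 (k : 'I_M.+1) : 0 <= fdiff (M - k) g k *+ 'C(M, k).
  by rewrite mulrn_wge0.
split; [exact: w0 | by move=> k; rewrite divr_ge0 | move=> s sN].
have sM : (s <= M)%N by rewrite ltnW // ltnS (leq_trans sN) // leq_addr.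
rewrite {1}(fdiff_bernstein g _ _ sM) -sumrB.
under eq_bigr do rewrite -mulrBr.
apply: le_trans (ler_norm_sum _ _ _) _.
apply: (@le_trans _ _ (\sum_(k < M.+1)
   (fdiff (M - k) g k *+ 'C(M, k)) * ((N ^ 2)%:R / M%:R))).
  apply: ler_sum => k _; rewrite normrM (ger0_norm (w0 k)) ler_wpM2l //.
  have [|_ H] := @ffact_ratio_bound R M k s isT sM; first by rewrite -ltnS.
  apply: le_trans H _.
  by rewrite ler_pM2r ?invr_gt0 // ler_nat leq_exp2r.
rewrite -mulr_suml.
have -> : \sum_(k < M.+1) (fdiff (M - k) g k *+ 'C(M, k)) = g 0.
  exact: (fdiff_binomial g M 0).
rewrite mulrA ler_pdivrMr // [eps * _]mulrC -ler_pdivrMr // [g 0 * _]mulrC.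
apply: le_trans (ltW (archi_boundP x0)) _.
by rewrite ler_nat ltnW // ltnS leq_addl.
Qed.

(** * Invertible matrices and small solutions *)

Lemma row_fullP_ker {F : fieldType} (r n : nat) (U : 'M[F]_(r, n)) :
  (forall v : 'cV_n, U *m v = 0 -> v = 0) -> row_full U.
Proof.
move=> inj; rewrite -cokermx_eq0; apply/eqP/matrixP => i j.
have /matrixP/(_ i 0) : col j (cokermx U) = 0.
  by apply: inj; rewrite colE mulmxA mulmx_coker mul0mx.
by rewrite !mxE.
Qed.

Lemma unitmx_small_solution {R : realFieldType} (p : nat) (B : 'M[R]_p)
    (eps : R) :
  B \in unitmx -> 0 < eps ->
  exists2 eta, 0 < eta & forall y : 'cV_p, (forall i, `|y i 0| <= eta) ->
    exists2 b : 'cV_p, B *m b = y & forall j, `|b j 0| <= eps.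
Proof.
(* [S] bounds every absolute row sum of the inverse; the summand 1 keeps it positive. *)
move=> Bu e0; pose S := 1 + \sum_j \sum_i `|invmx B j i|.
have row0 j : 0 <= \sum_i `|invmx B j i| by apply: sumr_ge0.
have S0 : 0 < S by rewrite ltr_pwDl // sumr_ge0.
exists (eps / S); first by rewrite divr_gt0.
move=> y ysmall; exists (invmx B *m y); first by rewrite mulKVmx.
move=> j; rewrite mxE; apply: le_trans (ler_norm_sum _ _ _) _.
apply: (@le_trans _ _ (\sum_i `|invmx B j i| * (eps / S))).
  by apply: ler_sum => i _; rewrite normrM ler_wpM2l.
rewrite -mulr_suml mulrA ler_pdivrMr // mulrC ler_pM2l //.
by rewrite /S [X in _ <= 1 + X](bigD1 j) //= addrCA lerDl addr_ge0 // sumr_ge0.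
Qed.

(** A nonzero polynomial with coefficients [v] has degree below [p] and cannot have [q >= p]
    distinct roots. *)
Lemma distinct_powers_indep {R : idomainType} (p q : nat) (t : 'I_q -> R)
    (v : 'cV[R]_p) :
  injective t -> (p <= q)%N ->
  (forall j, \sum_i v i 0 * t j ^+ i = 0) -> v = 0.
Proof.
move=> tinj pq v0; pose P := rVpoly v^T.
have sP : (size P <= p)%N by exact: size_poly.
suff P0 : P = 0.
  apply/matrixP => i j; rewrite (ord1 j).
  have -> : v i 0 = P`_i by rewrite coef_rVpoly_ord mxE.
  by rewrite P0 coef0 mxE.
apply/eqP; apply: contraT => Pn0.
have := @max_poly_roots _ P [seq t j | j <- enum 'I_q] Pn0.
rewrite size_map size_enum_ord ltnNge (leq_trans sP pq); apply.
  apply/allP => _ /mapP[j _ ->]; apply/rootP; rewrite (horner_coef_wide _ sP).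
  by rewrite -[RHS](v0 j); apply: eq_bigr => i _; rewrite coef_rVpoly_ord mxE.
by rewrite map_inj_uniq // enum_uniq.
Qed.

(** A kernel vector is a combination of [p] shifted powers vanishing at the [p] points i + c. *)
Lemma shifted_powR_unitmx {R : realType} (p : nat) (c a : R) : 0 < c -> 0 < a ->
  (\matrix_(i < p, j < p) (i%:R + c + j.+1%:R) `^ (- a)) \in unitmx.
Proof.
move=> c0 a0; rewrite -row_full_unit; apply: row_fullP_ker => v Gv.
pose t (j : 'I_p) : R := j.+1%:R.
have tinj : injective t by move=> i j /eqP; rewrite eqr_nat => /eqP[/val_inj].
(* The independence lemma indexes coefficients by the shift itself; as the shifts are distinct, this
   sum has one term at each of them. *)
pose b x : R := \sum_(j | t j == x) v j 0.
have bt j : b (t j) = v j 0.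
  by rewrite /b (big_pred1 j) // => i /=; rewrite (inj_eq tinj).
apply/matrixP => i j; rewrite (ord1 j) mxE -bt.
apply: (@shifted_powR_indep _ [seq t j | j <- enum 'I_p] a b
  [seq i%:R + c | i <- iota 0 p]) => //.
- by rewrite map_inj_uniq // enum_uniq.
- by move=> _ /mapP[k _ ->]; rewrite /t.
- apply: (homo_sorted _ _ (iota_ltn_sorted 0 p)) => k l kl.
  by rewrite ltrD2r ltr_nat.
- by move=> _ /mapP[k _ ->]; rewrite ltr_wpDl.
- by rewrite !size_map size_iota -enumT size_enum_ord.
- move=> _ /mapP[k + ->]; rewrite mem_iota add0n => kp.
  have /matrixP/(_ (Ordinal kp) 0) := Gv; rewrite !mxE => Gk.
  rewrite -[RHS]Gk big_map big_enum /=; apply: eq_bigr => l _.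
  by rewrite bt mxE mulrC.
- by rewrite map_f // mem_enum.
Qed.

(** * Exact finite moment representation *)

Lemma fdiff_sub_shifts {R : comNzRingType} (f : nat -> R) (p : nat)
    (b : 'I_p -> R) k s :
  fdiff k (fun s => f s - \sum_j b j * f (s + j.+1)%N) s =
  fdiff k f s - \sum_j b j * fdiff k f (s + j.+1).
Proof.
elim: k s => //= k IH s; rewrite !IH.
under [in RHS]eq_bigr => j _ do rewrite mulrBr -addSn.
by rewrite sumrB; ring.
Qed.

(** Each difference decreases in its argument, so [p] shifted copies with coefficients at most 1/p
    cannot outweigh the unshifted one. *)
Lemma powR_sub_small_shifts_monotone {R : realType} (c a : R) (p : nat)
    (b : 'I_p -> R) :
  0 < c -> 0 < a -> (forall j, `|b j| <= p%:R^-1) ->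
  forall k s, 0 <= fdiff k (fun s => (s%:R + c) `^ (- a) -
    \sum_j b j * ((s + j.+1)%:R + c) `^ (- a)) s.
Proof.
move=> c0 a0 bs k s.
rewrite (fdiff_sub_shifts (fun s => (s%:R + c) `^ (- a))) fdiff_powR subr_ge0.
have sc : 0 < s%:R + c by rewrite ltr_wpDl.
have [pos decr] := powR_diff_gt0_decr R k.
have := pos a _ a0 sc; set D := powR_diff a k _ => D0.
apply: (@le_trans _ _ (\sum_(j < p) p%:R^-1 * D)).
  apply: ler_sum => j _; apply: le_trans (ler_norm _) _.
  rewrite normrM fdiff_powR ler_pM // ger0_norm.
    by rewrite ltW // decr // ltrD2r ltr_nat -addSnnS leq_addr.
  by rewrite ltW // pos // ltr_wpDl.
rewrite sumr_const card_ord -[leLHS]mulr_natl mulrA; case: p {b bs} => [|p].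
  by rewrite mul0r mul0r ltW.
by rewrite divff ?pnatr_eq0 // mul1r.
Qed.

(** The map [f] singles out N+1 terms of positive weight at distinct nodes; these later make the
    vectors span. *)
Lemma powR_finite_moments {R : realType} (c a : R) (N : nat) : 0 < c -> 0 < a ->
  exists r (w t : 'I_r -> R) (f : 'I_N.+1 -> 'I_r),
    [/\ forall k, 0 <= w k, forall k, 0 <= t k,
        forall j, 0 < w (f j), injective (t \o f) &
        forall s, (s <= N)%N -> (s%:R + c) `^ (- a) = \sum_k w k * t k ^+ s].
Proof.
move=> c0 a0; pose x (j : 'I_N.+1) : R := j%:R.
have xinj : injective x by move=> i j /eqP; rewrite eqr_nat => /eqP/val_inj.
pose e s : R := \sum_j x j ^+ s.
pose V : 'M[R]_N.+1 := \matrix_(s, j) x j ^+ s.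
have Vu : V \in unitmx.
  rewrite -unitmx_tr -row_full_unit; apply: row_fullP_ker => v Vv.
  apply: (distinct_powers_indep _ _ _ _ xinj (leqnn _)) => j.
  have /matrixP/(_ j 0) := Vv; rewrite !mxE => Vj; rewrite -[RHS]Vj.
  by apply: eq_bigr => i _; rewrite !mxE mulrC.
have e_ge0 s : 0 <= e s by apply: sumr_ge0 => j _; rewrite exprn_ge0 // ler0n.
have pinv0 : 0 < N.+1%:R^-1 :> R by rewrite invr_gt0 ltr0n.
have [eta eta0 Geta] := unitmx_small_solution _ _ _
  (shifted_powR_unitmx N.+1 c a c0 a0) pinv0.
(* [E] dominates each [e s] with s <= N, so [d * e s] stays within [eta]. *)
pose E := 1 + \sum_(s < N.+1) e s.
have E0 : 0 < E by rewrite ltr_pwDl // sumr_ge0.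
pose d := eta / E.
have d0 : 0 < d by rewrite divr_gt0.
have [|b Gb bsmall] := Geta (\col_s (d * e s)).
  move=> s; rewrite mxE ger0_norm; last exact: mulr_ge0 (ltW d0) (e_ge0 s).
  rewrite /d mulrAC ler_pdivrMr // ler_pM2l //.
  by rewrite /E (bigD1 s) //= addrCA lerDl addr_ge0 // sumr_ge0.
have cm := powR_sub_small_shifts_monotone c a _ (fun j => b j 0) c0 a0 bsmall.
(* Corrections of size at most d/2 leave the weights [d + y j 0] positive. *)
have d20 : 0 < d / 2 by rewrite divr_gt0.
have [eta2 eta20 Veta] := unitmx_small_solution _ _ _ Vu d20.
have [r [w [t [w0 t0 approx]]]] := completely_monotone_approx _ N _ cm eta20.
(* The completely monotone sequence agrees with h - d e only up to [N], the range of the linear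
   system. *)
have hE s : (s <= N)%N -> (s%:R + c) `^ (- a) -
    \sum_j b j 0 * ((s + j.+1)%:R + c) `^ (- a) = (s%:R + c) `^ (- a) - d * e s.
  move=> sN; congr (_ - _).
  have /matrixP/(_ (Ordinal (sN : (s < N.+1)%N)) 0) := Gb; rewrite !mxE => Gs.
  rewrite -[RHS]Gs; apply: eq_bigr => j _.
  by rewrite mxE mulrC natrD addrAC.
have [|y Vy ysmall] := Veta (\col_s ((s%:R + c) `^ (- a) - d * e s -
    \sum_k w k * t k ^+ s)).
  move=> s; have sN : (s <= N)%N by rewrite -ltnS.
  by rewrite mxE -hE // approx.
have dy j : 0 < d + y j 0.
  rewrite -ltrBlDl sub0r; apply: (@lt_le_trans _ _ (- (d / 2))).
    by rewrite ltrN2 ltr_pdivrMr // ltr_pMr // ltr1n.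
  by have := ysmall j; rewrite ler_norml => /andP[].
(* The final family joins the [r] Bernstein terms to the nodes 0, ..., N with weights
   [d + y j 0]. *)
pose glue (u : 'I_r -> R) (v : 'I_N.+1 -> R) (k : 'I_(r + N.+1)) :=
  match split k with inl i => u i | inr j => v j end.
have gluel u v i : glue u v (lshift N.+1 i) = u i.
  by rewrite /glue (unsplitK (inl i)).
have gluer u v j : glue u v (rshift r j) = v j.
  by rewrite /glue (unsplitK (inr j)).
exists (r + N.+1)%N, (glue w (fun j => d + y j 0)), (glue t x).
exists (@rshift r N.+1).
split.
- by move=> k; case: (split_ordP k) => [i ->|j ->]; rewrite ?gluel // gluer ltW.
- move=> k; case: (split_ordP k) => [i ->|j ->]; rewrite ?gluel //.
  by rewrite gluer ler0n.
- by move=> j; rewrite gluer.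
- by move=> i j /=; rewrite !gluer; apply: xinj.
move=> s sN; rewrite big_split_ord /=.
under eq_bigr do rewrite !gluel.
under [X in _ = _ + X]eq_bigr do rewrite !gluer mulrDl.
rewrite big_split /= -mulr_sumr -/(e s).
have /matrixP/(_ (Ordinal (sN : (s < N.+1)%N)) 0) := Vy; rewrite !mxE /= => Vs.
have -> : \sum_j y j 0 * x j ^+ s =
    (s%:R + c) `^ (- a) - d * e s - \sum_k w k * t k ^+ s.
  by rewrite -[RHS]Vs; apply: eq_bigr => j _; rewrite mxE mulrC.
ring.
Qed.

(** * Decomposition of the Hilbert tensor *)

Lemma hpow_gen_hilbert_tensorE {R : realType} (m n : nat) (c a : R)
    (i : midx m n) :
  0 < c -> hpow_tensor (@gen_hilbert_tensor R m n c) a i =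
  ((\sum_(k < m) (i k : nat))%:R + c) `^ (- a).
Proof.
move=> c0; rewrite /hpow_tensor /gen_hilbert_tensor.
by rewrite -powR_inv1 ?addr_ge0 ?ler0n ?(ltW c0) // -powRrM mulN1r.
Qed.

Lemma symmetric_hpow_gen_hilbert {R : realType} (m n : nat) (c a : R) :
  symmetric_tensor (hpow_tensor (@gen_hilbert_tensor R m n c) a).
Proof.
move=> s i; rewrite /hpow_tensor /gen_hilbert_tensor.
rewrite [in RHS](reindex_inj (@perm_inj _ s)) /=.
by under eq_bigr do rewrite ffunE.
Qed.

(** The trivial kernel serves twice: it yields spanning, and it rules out zeros of the form of even
    order. *)
Lemma gen_hilbert_decomposition {R : realType} (m n : nat) (c a : R) :
  0 < c -> 0 < a -> (0 < m)%N ->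
  exists (r : nat) (U : 'M[R]_(r, n)),
    [/\ forall k j, 0 <= U k j, forall v : 'cV_n, U *m v = 0 -> v = 0 &
    forall i, hpow_tensor (@gen_hilbert_tensor R m n c) a i =
      \sum_(k < r) @rank1_tensor R m n (fun j => U k j) i].
Proof.
move=> c0 a0 m0.
have [r [w [t [f [w0 t0 wf tf wt]]]]] := powR_finite_moments c a (m * n) c0 a0.
exists r, (\matrix_(k, j) (w k `^ m%:R^-1 * t k ^+ j)); split.
- by move=> k j; rewrite mxE mulr_ge0 ?powR_ge0 ?exprn_ge0.
(* Only the rows [f j] are used: their positive weights cancel, leaving a polynomial with at least
   [n] distinct roots. *)
- move=> v Uv; apply: (distinct_powers_indep _ _ _ _ tf).
    by rewrite ltnW // ltnS leq_pmull.
  move=> j; have /matrixP/(_ (f j) 0) := Uv; rewrite !mxE => Uj.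
  have /eqP : w (f j) `^ m%:R^-1 * \sum_i v i 0 * t (f j) ^+ i = 0.
    rewrite -[RHS]Uj mulr_sumr; apply: eq_bigr => i _.
    by rewrite mxE mulrA mulrAC.
  by rewrite mulf_eq0 (gt_eqF (powR_gt0 _ (wf j))) => /eqP.
move=> i; rewrite hpow_gen_hilbert_tensorE // wt.
  apply: eq_bigr => k _; rewrite /rank1_tensor.
  under [RHS]eq_bigr do rewrite mxE.
  rewrite big_split /= prodr_const card_ord -expr_sum; congr (_ * _).
  rewrite -powR_mulrn ?powR_ge0 // -powRrM mulVf ?powRr1 //.
  by rewrite pnatr_eq0 -lt0n.
(* The remaining goal bounds the index sum by [m * n]: each of the [m] indices is below [n]. *)
rewrite -[m in (m * n)%N]card_ord -sum_nat_const.
by apply: leq_sum => k _; rewrite ltnW.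
Qed.

(** Distributing the product of [m] equal linear forms produces one term per multi-index. *)
Lemma rank1_tensor_form {R : realType} (m n : nat) (u x : 'I_n -> R) :
  \sum_(i : midx m n) @rank1_tensor R m n u i * \prod_(k < m) x (i k) =
  (\sum_j u j * x j) ^+ m.
Proof.
transitivity (\prod_(k < m) \sum_j u j * x j); last first.
  by rewrite prodr_const card_ord.
under eq_bigr do rewrite /rank1_tensor -big_split /=.
by rewrite -(bigA_distr_bigA (fun _ j => u j * x j)).
Qed.

Theorem theorem4p4 (R : realType) (n : nat) (c alpha : R) :
  (2 <= n)%N -> 0 < c -> 0 < alpha ->
  posdef_mx (hpow_mx (@gen_hilbert_mx R n c) alpha) ->
  forall m : nat, (2 <= m)%N ->
    strongly_cp (hpow_tensor (@gen_hilbert_tensor R m n c) alpha) /\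
    (~~ odd m -> posdef_tensor (hpow_tensor (@gen_hilbert_tensor R m n c) alpha)).
Proof.
move=> _ c0 a0 _ m m2; have m0 := ltnW m2.
have [r [U [U0 Uinj AU]]] := @gen_hilbert_decomposition R m n c alpha c0 a0 m0.
split.
  split; first exact: symmetric_hpow_gen_hilbert.
  by exists r, U; split=> //; split=> //; apply: row_fullP_ker.
move=> mev; split; first exact: symmetric_hpow_gen_hilbert.
move=> x [j xj].
pose y k := \sum_j U k j * x j.
have -> : \sum_(i : midx m n)
    hpow_tensor (@gen_hilbert_tensor R m n c) alpha i *
    \prod_(k < m) x (i k) = \sum_(k < r) y k ^+ m.
  under eq_bigr do rewrite AU mulr_suml.
  by rewrite exchange_big; apply: eq_bigr => k _; rewrite rank1_tensor_form.
(* A sum of even powers vanishes only if every [y k] does, that is, if [U] kills [x]. *)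
have ym k : 0 <= y k ^+ m by rewrite exprn_even_ge0.
rewrite lt_def sumr_ge0 // andbT; apply: contra xj => /eqP/psumr_eq0P y0.
have /matrixP/(_ j 0) : \col_j x j = 0.
  apply: Uinj; apply/matrixP => k l; rewrite !mxE.
  have /eqP := y0 (fun k _ => ym k) k isT; rewrite expf_eq0 m0 => /eqP yk.
  by rewrite -[RHS]yk; apply: eq_bigr => i _; rewrite mxE.
by rewrite !mxE => ->.
Qed.
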